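(* Let $K_1,\dots,K_n\in\mathcal F_0$, let $-n<p<0$ and $\alpha\in\{1,2\}$. For every integer $m$ with $1\le m\le n$, $$\big[G_p^{(\alpha)}(K_1,\dots,K_n)\big]^m\le\prod_{i=0}^{m-1}G_p^{(\alpha)}(K_1,\dots,K_{n-m},\underbrace{K_{n-i},\dots,K_{n-i}}_{m}).$$ In particular, for $m=n$, $$\big[G_p^{(\alpha)}(K_1,\dots,K_n)\big]^n\le\widetilde G_p(K_1)\cdots\widetilde G_p(K_n).$$
   Context: Notation in $\mathbb R^n$: $S^{n-1}$ is the unit sphere with spherical measure $\sigma$ and $|\cdot|$ is volume. $\mathcal K_0$ is the set of convex bodies (compact convex sets) containing the origin in their interior. For $K\in\mathcal K_0$: $h_K(u)=\max_{x\in K}\langle x,u\rangle$ and $K^\circ=\{x:\langle x,y\rangle\le1\ \forall y\in K\}$. $\mathcal F_0$ is the set of $K\in\mathcal K_0$ whose surface area measure $S(K,\cdot)$ on $S^{n-1}$ is absolutely continuous with respect to $\sigma$, with density $f_K$ (curvature function); $f_p(K,u)=h_K(u)^{1-p}f_K(u)$. For $\mathbf K=(K_1,\dots,K_n)\in\mathcal F_0^n$ and $\mathbf L=(L_1,\dots,L_n)\in\mathcal K_0^n$, $V_p(\mathbf K;\mathbf L)=\frac1n\int_{S^{n-1}}\prod_{i=1}^n[h_{L_i}(u)^pf_p(K_i,u)]^{\frac1n}d\sigma(u)$. For $-n<p<0$, $$G_p^{(1)}(K_1,\dots,K_n)=\sup_{L\in\mathcal K_0}\Big\{nV_p(\mathbf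 K;L,\dots,L)^{\frac n{n+p}}|L^\circ|^{\frac p{n+p}}\Big\},$$ $$G_p^{(2)}(K_1,\dots,K_n)=\sup_{\mathbf L\in\mathcal K_0^n}\Big\{nV_p(\mathbf K;\mathbf L)^{\frac n{n+p}}\prod_{i=1}^n|L_i^\circ|^{\frac p{(n+p)n}}\Big\}.$$ For $K\in\mathcal K_0$ and $-n<p<0$, the $L_p$ geominimal surface area is $\widetilde G_p(K)=\sup_{L\in\mathcal K_0}\{nV_p(K,L)^{\frac n{n+p}}|L^\circ|^{\frac p{n+p}}\}$, where $V_p(K,L)=\frac1n\int_{S^{n-1}}h_L(u)^ph_K(u)^{1-p}dS(K,u)$. Suprema are taken in $[0,+\infty]$, with $0\cdot(+\infty)=0$. *)

(* Defs.v *)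
From HB Require Import structures.
From mathcomp Require Import all_boot all_order all_algebra.
From mathcomp Require Import all_classical all_reals all_analysis.

Set Implicit Arguments.
Unset Strict Implicit.
Unset Printing Implicit Defensive.

Import Order.TTheory GRing.Theory Num.Theory.
Import numFieldNormedType.Exports.

Local Open Scope classical_set_scope.
Local Open Scope ring_scope.

(* R^n is 'rV[R]_n; its library norm is the sup norm, so the Euclidean
   structure is introduced here.  The library topology is the usual one. *)

Definition dot (R : realType) (n : nat) (x y : 'rV[R]_n) : R :=
  \sum_(i < n) x ord0 i * y ord0 i.

Definition enorm (R : realType) (n : nat) (x : 'rV[R]_n) : R :=
  Num.sqrt (dot x x).

Definition sphere (R : realType) (n : nat) : set 'rV[R]_n :=
  [set u | enorm u = 1].

Definition unit_ball (R : realType) (n : nat) : set 'rV[R]_n :=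
  [set x | enorm x <= 1].

Definition borel (R : realType) (n : nat) :=
  g_sigma_algebraType (@open 'rV[R]_n).

(* n-dimensional Lebesgue measure, as the iterated product of the
   one-dimensional one: the successor clause is what the library's product
   measure unfolds to, with R x R^n identified with R^(n+1). *)
Fixpoint lebesgue_rV (R : realType) (n : nat) : set 'rV[R]_n -> \bar R :=
  match n with
  | 0%N => fun A => (\1_A 0)%:E
  | n'.+1 => fun A =>
      (\int[lebesgue_measure]_(t in [set: R])
         lebesgue_rV [set y : 'rV[R]_n' | A (row_mx t%:M y)])%E
  end.

Definition vol (R : realType) (n : nat) (A : set 'rV[R]_n) : R :=
  fine (lebesgue_rV A).

Definition ediam (R : realType) (n : nat) (A : set 'rV[R]_n) : \bar R :=
  ereal_sup [set (enorm (z.1 - z.2))%:E | z in A `*` A].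

(* The power diam ^ s with the conventions diam(set0) ^ s = 0 and, for
   nonempty A, diam(A) ^ 0 = 1, so that hausdorff 0 is counting measure. *)
Definition diam_pow (R : realType) (n s : nat) (A : set 'rV[R]_n) : \bar R :=
  if A == set0 then 0%E else (ediam A ^+ s)%E.

Definition hausdorff_pre (R : realType) (n s : nat) (d : R)
    (A : set 'rV[R]_n) : \bar R :=
  ereal_inf [set (\sum_(k <oo) diam_pow s (F k))%E | F in
    [set F : nat -> set 'rV[R]_n |
      A `<=` \bigcup_k F k /\ forall k, (ediam (F k) <= d%:E)%E]].

(* Normalized by vol(unit ball of R^s) / 2^s: s-dimensional Hausdorff measure
   is then s-dimensional area, and Lebesgue measure when s = n. *)
Definition hausdorff (R : realType) (n s : nat) (A : set 'rV[R]_n) : \bar R :=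
  ((vol (@unit_ball R s) / 2 ^+ s)%:E *
   ereal_sup [set hausdorff_pre s d A | d in [set d : R | (0 < d)%R]])%E.

Definition spherical_measure (R : realType) (n : nat) :
    set (borel R n) -> \bar R :=
  fun A => hausdorff n.-1 (A `&` @sphere R n).

Definition K0 (R : realType) (n : nat) : set (set 'rV[R]_n) :=
  [set K : set 'rV[R]_n |
     [/\ compact K, convex_set K & interior K 0]].

Definition support_function (R : realType) (n : nat) (K : set 'rV[R]_n)
    (u : 'rV[R]_n) : R :=
  sup [set dot x u | x in K].

Definition polar (R : realType) (n : nat) (K : set 'rV[R]_n) :
    set 'rV[R]_n :=
  [set x | forall y, K y -> dot x y <= 1].

(* S(K, A) is the (n-1)-dimensional Hausdorff measure of the set of boundary
   points of K having an outer unit normal in A. *)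
Definition surface_area (R : realType) (n : nat) (K : set 'rV[R]_n) :
    set (borel R n) -> \bar R :=
  fun A => hausdorff n.-1
    [set x | (K `\` interior K) x /\
       exists u, [/\ A u, @sphere R n u & dot x u = support_function K u]].

Definition is_curvature_function (R : realType) (n : nat)
    (K : set 'rV[R]_n) (f : borel R n -> R) : Prop :=
  [/\ measurable_fun (@sphere R n : set (borel R n)) f,
      forall u, @sphere R n u -> 0 <= f u
    & forall A : set (borel R n), measurable A -> A `<=` @sphere R n ->
        surface_area K A =
        (\int[@spherical_measure R n]_(u in A) (f u)%:E)%E].

Definition F0 (R : realType) (n : nat) : set (set 'rV[R]_n) :=
  [set K | [/\ K0 K,
     @surface_area R n K `<< @spherical_measure R n
   & exists f, is_curvature_function K f]].

(* The density is unique only up to a null set for the spherical measure;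
   a representative is chosen. *)
Definition curvature (R : realType) (n : nat) (K : set 'rV[R]_n) :
    borel R n -> R :=
  xget (cst 0) [set f | is_curvature_function K f].

Definition curvature_p (R : realType) (n : nat) (p : R) (K : set 'rV[R]_n)
    (u : borel R n) : R :=
  support_function K u `^ (1 - p) * curvature K u.

Definition mixed_Vp (R : realType) (n : nat) (p : R)
    (K L : 'I_n -> set 'rV[R]_n) : \bar R :=
  ((n%:R^-1)%:E *
   \int[@spherical_measure R n]_(u in @sphere R n)
     (\prod_(i < n)
        (support_function (L i) u `^ p * curvature_p p (K i) u) `^ n%:R^-1)%:E)%E.

Definition G1 (R : realType) (n : nat) (p : R) (K : 'I_n -> set 'rV[R]_n) :
    \bar R :=
  ereal_sup [set (n%:R%:E * mixed_Vp p K (fun=> L) `^ (n%:R / (n%:R + p)) *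
                  (vol (polar L) `^ (p / (n%:R + p)))%:E)%E
            | L in @K0 R n].

Definition G2 (R : realType) (n : nat) (p : R) (K : 'I_n -> set 'rV[R]_n) :
    \bar R :=
  ereal_sup [set (n%:R%:E * mixed_Vp p K L `^ (n%:R / (n%:R + p)) *
                  (\prod_(i < n)
                     vol (polar (L i)) `^ (p / ((n%:R + p) * n%:R)))%:E)%E
            | L in [set L : 'I_n -> set 'rV[R]_n | forall i, K0 (L i)]].

Definition G (R : realType) (n : nat) (alpha : nat) (p : R)
    (K : 'I_n -> set 'rV[R]_n) : \bar R :=
  if alpha == 1%N then G1 p K else G2 p K.

Definition Vp (R : realType) (n : nat) (p : R) (K L : set 'rV[R]_n) :
    \bar R :=
  ((n%:R^-1)%:E *
   \int[@surface_area R n K]_(u in @sphere R n)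
     (support_function L u `^ p * support_function K u `^ (1 - p))%:E)%E.

Definition geominimal (R : realType) (n : nat) (p : R) (K : set 'rV[R]_n) :
    \bar R :=
  ereal_sup [set (n%:R%:E * Vp p K L `^ (n%:R / (n%:R + p)) *
                  (vol (polar L) `^ (p / (n%:R + p)))%:E)%E
            | L in @K0 R n].

(* Main.v *)
(* Write F = prod_j g_j^(1/n) for the integrand of V_p(K; L), with
   g_j = h_(L_j)^p f_p(K_j).  Then F^m is the product over i < m of the integrands
   obtained by replacing the last m pairs (K_j, L_j) by the single pair with index
   n-i, so Hoelder's inequality bounds V_p(K; L)^m by the product of the
   corresponding mixed volumes.  The volumes of the polar bodies match exactly
   under the same replacement, and taking suprema gives the first inequality.
   For m = n the functions g_j themselves appear instead, and the integral of g_j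
   is V_p(K_j, L_j) because f_(K_j) is the density of S(K_j, .).
   Hoelder's inequality needs the spherical measure to be a measure on the Borel
   sets: Hausdorff measure is a metric outer measure, so Caratheodory's criterion
   applies. *)

From HB Require Import structures.
Require Import Defs.
From mathcomp Require Import all_boot all_order all_algebra.
From mathcomp Require Import all_classical all_reals all_analysis.
From mathcomp Require Import measurable_realfun.
From mathcomp Require Import ring zify.

Set Implicit Arguments.
Unset Strict Implicit.
Unset Printing Implicit Defensive.

Import Order.TTheory GRing.Theory Num.Theory.
Local Open Scope ring_scope.

Import numFieldNormedType.Exports.
Local Open Scope classical_set_scope.

(** * Metric outer measures *)

Section metric_outer_measure.
Context (R : realType) (T : pseudoMetricType R).
Variable mu : {outer_measure set T -> \bar R}.
Hypothesis mu_separated : forall (A B : set T) (e : R), 0 < e ->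
  (forall x y, A x -> B y -> ~ ball x e y) ->
  (mu A + mu B <= mu (A `|` B))%E.
Local Open Scope ereal_scope.

Let core (U : set T) (k : nat) : set T :=
  [set x | ball x k.+1%:R^-1 `<=` U].

Let core_mono U k : core U k `<=` core U k.+1.
Proof.
move=> x /= xU y yx; apply: xU; apply: le_ball yx.
by rewrite lef_pV2 ?posrE// ler_nat.
Qed.

(** By the triangle inequality, the ball of radius 1/(k+2) about a point within the gap of [x] stays
    in the ball of radius 1/(k+1) about [x]. *)
Let core_separated U k x y :
  core U k x -> ~ core U k.+1 y -> ~ ball x (k.+1%:R^-1 - k.+2%:R^-1) y.
Proof.
move=> xU yU xy; apply: yU => z yz; apply: xU.
by have := ball_triangle xy yz; rewrite subrK.
Qed.

Let gap_gt0 k : (0 < k.+1%:R^-1 - k.+2%:R^-1 :> R)%R.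
Proof. by rewrite subr_gt0 ltf_pV2 ?posrE// ltr_nat. Qed.

Let shell U X k := X `&` (core U k.+1 `\` core U k).

Let shell_step U X k :
  mu (X `&` core U k) + mu (shell U X k.+1) <= mu (X `&` core U k.+2).
Proof.
apply: (le_trans (mu_separated (gap_gt0 k) _)).
  by move=> x y [_ xk] [_ [_ yk]]; exact: core_separated xk yk.
apply: le_outer_measure => x [[Xx xk]|[Xx [xk _]]]; split => //.
by apply: core_mono; exact: core_mono.
Qed.

(** Shell N+1 avoids [core U N.+1], so it is separated from [core U N] and merges with it inside
    [core U N.+2]. The two terms on the right keep track of the two parities of shells. *)
Let shell_sum U X N : \sum_(0 <= k < N.+1) mu (shell U X k) <=
  mu (X `&` core U N.+1) + mu (X `&` core U N).
Proof.
elim: N => [|N IH].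
  rewrite big_nat1 -[leLHS]adde0; apply: leeD; last exact: outer_measure_ge0.
  by apply: le_outer_measure => x [Xx [xk _]]; split.
rewrite big_nat_recr//=; apply: (le_trans (leeD2r _ IH)).
by rewrite -addeA addeC; apply: leeD2r; exact: shell_step.
Qed.

(* The set [U] is exhausted by the points at distance at least [1/(k+1)] from
   its complement; non-adjacent shells of this exhaustion are separated, so the
   sum of their outer measures converges and its tails vanish. *)
Lemma metric_outer_measure_open (U : set T) : open U -> mu.-caratheodory U.
Proof.
move=> oU; apply: le_caratheodory_measurable => X.
have [->|Xoo] := eqVneq (mu X) +oo; first by rewrite leey.
have Xfin : mu X \is a fin_num by rewrite ge0_fin_numE ?outer_measure_ge0// ltey.
have muXI A : mu (X `&` A) <= mu X by apply: le_outer_measure => x [].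
(* Each point of the core has a ball of radius 1/(k+1) inside [U], so the core is separated from the
   complement of [U]. *)
have core_compl k : mu (X `&` core U k) + mu (X `&` ~` U) <= mu X.
  have e0 : (0 < k.+1%:R^-1 :> R)%R by rewrite invr_gt0.
  apply: (le_trans (mu_separated e0 _)); last first.
    by apply: le_outer_measure => x [[]|[]].
  by move=> x y [_ xk] [_ yU] xy; apply: yU; exact: xk.
have tail0 : \sum_(N <= k <oo) mu (shell U X k) @[N --> \oo] --> 0.
  apply: nneseries_tail_cvg; last by move=> *; exact: outer_measure_ge0.
  apply: (@le_lt_trans _ _ (mu X + mu X)); last by rewrite lte_add_pinfty ?ltey.
  apply: lime_le; first by apply: is_cvg_nneseries => *; exact: outer_measure_ge0.
  near=> N; have N0 : (0 < N)%N by near: N; exact: nbhs_infty_gt.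
  rewrite -(prednK N0); apply: (le_trans (shell_sum U X N.-1)).
  exact: leeD.
have coreU : U `<=` \bigcup_k core U k.
  move=> x Ux; have /nbhs_ballP[e /= e0 eU] : nbhs x U by exact: open_nbhs_nbhs.
  (* This index k satisfies 1/(k+1) < [e]. *)
  exists (Num.truncn e^-1) => //= y xy; apply: eU; apply: le_ball xy.
  by rewrite invf_ple ?posrE// ltW// truncnS_gt.
have Xcover N : mu (X `&` U) <=
    mu (X `&` core U N) + \sum_(N <= k <oo) mu (shell U X k).
  apply: (@le_trans _ _ (mu ((X `&` core U N) `|`
      \bigcup_(k in ~` `I_N) shell U X k))); last first.
    apply: (le_trans (outer_measureU2 _ _ _)).
    by apply: leeD2l; exact: outer_measure_sigma_subadditive_tail.
  apply: le_outer_measure => x [Xx Ux].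
  have [k _ xk] := coreU x Ux.
  have [xN|xN] := pselect (core U N x); [by left|right].
  (* The induction descends to the first core containing [x], which places [x] in the shell just
     below it. Since cores increase and core [N] misses [x], the index of that shell is at least
     [N]. *)
  elim: k xk => [|k IH] xk.
    exfalso; apply: xN; elim: N => [//|N IH]; exact: core_mono.
  have [/IH//|xk'] := pselect (core U k x).
  exists k => //=; apply/negP; rewrite -ltnNge ltnNge; apply/negP => Nk.
  apply: xN; rewrite -(subnKC Nk); elim: (N - k.+1)%N => [|j IHj].
    by rewrite addn0.
  by rewrite addnS; exact: core_mono.
suff le_tail N : mu (X `&` U) + mu (X `&` ~` U) <=
    mu X + \sum_(N <= k <oo) mu (shell U X k).
  have cvgX : (mu X + \sum_(N <= k <oo) mu (shell U X k)) @[N --> \oo] --> mu X.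
    rewrite -[X in _ --> X]adde0; apply: cvgeD tail0; last exact: cvg_cst.
    by rewrite fin_num_adde_defr.
  rewrite -(cvg_lim _ cvgX)//; apply: lime_ge; first by apply/cvg_ex; exists (mu X).
  by apply: nearW => N; exact: le_tail.
apply: (le_trans (leeD2r _ (Xcover N))).
by rewrite addeAC; apply: leeD2r; exact: core_compl.
Unshelve. all: by end_near. Qed.

End metric_outer_measure.

(** * Hausdorff measure and the spherical measure *)

(** Unless [z] is infinite, nonnegativity and nonemptiness make all terms finite, so the bound can
    be rearranged by subtraction and each supremum taken in turn. *)
Lemma ereal_sup_add_le (R : realType) (X Y : set \bar R) (z : \bar R) :
  X !=set0 -> Y !=set0 ->
  (forall x, X x -> (0 <= x)%E) -> (forall y, Y y -> (0 <= y)%E) ->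
  (forall x y, X x -> Y y -> (x + y <= z)%E) ->
  (ereal_sup X + ereal_sup Y <= z)%E.
Proof.
move=> [x0 Xx0] [y0 Yy0] X0 Y0 XYz.
have [->|zoo] := eqVneq z +oo%E; first by rewrite leey.
have zfin : z \is a fin_num.
  rewrite ge0_fin_numE ?ltey//; apply: le_trans (XYz _ _ Xx0 Yy0).
  by apply: adde_ge0; [exact: X0|exact: Y0].
have Xfin x : X x -> x \is a fin_num.
  move=> Xx; rewrite ge0_fin_numE; last exact: X0.
  apply: (@le_lt_trans _ _ (x + y0)%E); first by apply: leeDl; exact: Y0.
  by apply: le_lt_trans (XYz _ _ Xx Yy0) _; rewrite ltey.
have supYle x : X x -> (ereal_sup Y <= z - x)%E.
  move=> Xx; apply: ge_ereal_sup => y Yy.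
  by rewrite leeBrDr ?Xfin// addeC XYz.
have Yfin : ereal_sup Y \is a fin_num.
  have supY0 : (0 <= ereal_sup Y)%E.
    by apply: le_trans (Y0 _ Yy0) _; exact: ereal_sup_ubound.
  rewrite ge0_fin_numE//; apply: le_lt_trans (supYle _ Xx0) _.
  by rewrite ltey_eq fin_numB zfin Xfin.
rewrite -leeBrDr//; apply: ge_ereal_sup => x Xx.
by rewrite leeBrDr// -leeBrDl ?Xfin// supYle.
Qed.

Lemma lebesgue_rV_ge0 (R : realType) (n : nat) (A : set 'rV[R]_n) :
  (0 <= lebesgue_rV A)%E.
Proof.
elim: n A => [|n IH] A /=; first by rewrite lee_fin.
by apply: integral_ge0 => t _; exact: IH.
Qed.

Section hausdorff_outer_measure.
Context (R : realType) (n : nat).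
Local Open Scope ereal_scope.

Lemma ediam_ge0 (A : set 'rV[R]_n) : A !=set0 -> 0 <= ediam A.
Proof.
move=> [x Ax]; apply: le_ereal_sup_tmp; exists (enorm (x - x))%:E.
  by exists (x, x).
by rewrite lee_fin sqrtr_ge0.
Qed.

Lemma diam_pow_ge0 s (A : set 'rV[R]_n) : 0 <= diam_pow s A.
Proof.
rewrite /diam_pow; case: eqVneq => // /set0P A0; apply: expe_ge0.
exact: ediam_ge0.
Qed.

Let capped_diam_pow (s : nat) (d : R) (A : set 'rV[R]_n) : \bar R :=
  if ediam A <= d%:E then diam_pow s A else +oo.

Let capped_ge0 s d A : 0 <= capped_diam_pow s d A.
Proof. by rewrite /capped_diam_pow; case: ifP => // _; exact: diam_pow_ge0. Qed.

Let capped0 s d : capped_diam_pow s d set0 = 0.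
Proof.
rewrite /capped_diam_pow /ediam setX0 image_set0 ereal_sup0 leNye.
by rewrite /diam_pow eqxx.
Qed.

(* Covering sets of too large diameter are given measure [+oo], which makes
   [hausdorff_pre] an outer measure generated by a total set function. *)
Let hausdorff_preE s d : hausdorff_pre s d =
  @mu_ext _ (g_sigma_algebraType [set: set 'rV[R]_n]) R (capped_diam_pow s d).
Proof.
apply/funext => A; apply/eqP; rewrite eq_le; apply/andP; split.
  apply: le_ereal_inf_tmp => _ [F [_ AF] <-].
  (* A cover with a member of diameter above [d] has infinite capped sum, and the bound is then
     trivial. *)
  have [Fd|/existsNP[k /negP Fk]] := pselect (forall k, ediam (F k) <= d%:E).
    apply: ereal_inf_lbound; exists F => //.
    by apply: eq_eseriesr => k _; rewrite /capped_diam_pow Fd.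
  rewrite [leRHS](eseries_pinfty _ (k := k)) ?leey//.
    by move=> i _; rewrite gt_eqF// (lt_le_trans _ (capped_ge0 _ _ _)).
  by rewrite /capped_diam_pow (negbTE Fk).
apply: le_ereal_inf_tmp => _ [F [AF Fd] <-].
apply: ereal_inf_lbound; exists F.
  by split => // i; apply: sub_sigma_algebra.
by apply: eq_eseriesr => k _; rewrite /capped_diam_pow Fd.
Qed.

Lemma hausdorff_pre_ge0 s d (A : set 'rV[R]_n) : 0 <= hausdorff_pre s d A.
Proof. by rewrite hausdorff_preE; apply: mu_ext_ge0. Qed.

Lemma hausdorff_pre0 s d : hausdorff_pre s d (set0 : set 'rV[R]_n) = 0.
Proof. by rewrite hausdorff_preE; apply: mu_ext0. Qed.

Lemma le_hausdorff_pre s d :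
  {homo @hausdorff_pre R n s d : A B / A `<=` B >-> A <= B}.
Proof. by move=> A B AB; rewrite hausdorff_preE; apply: le_mu_ext. Qed.

Lemma hausdorff_pre_sigma_subadditive s d :
  sigma_subadditive (@hausdorff_pre R n s d).
Proof.
move=> F; rewrite hausdorff_preE.
exact: mu_ext_sigma_subadditive.
Qed.

Lemma hausdorff_pre_antitone s (d e : R) (A : set 'rV[R]_n) : (d <= e)%R ->
  hausdorff_pre s e A <= hausdorff_pre s d A.
Proof.
move=> de; apply/ereal_inf_le_tmp => _ [F [AF Fd] <-]; exists F => //; split => // k.
by apply: le_trans (Fd k) _; rewrite lee_fin.
Qed.

Lemma coord_le_enorm (x : 'rV[R]_n) j : (`|x ord0 j| <= enorm x)%R.
Proof.
rewrite -sqrtr_sqr ler_wsqrtr// /dot (bigD1 j)//= -expr2 lerDl.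
by apply: sumr_ge0 => i _; rewrite -expr2 sqr_ge0.
Qed.

(** A set of Euclidean diameter at most [d] < [e] cannot meet both [A] and [B], so each member of a
    cover of the union is charged to at most one of them. *)
Lemma hausdorff_pre_separated s (d e : R) (A B : set 'rV[R]_n) : (d < e)%R ->
  (0 < e)%R ->
  (forall x y, A x -> B y -> ~ ball x e y) ->
  hausdorff_pre s d A + hausdorff_pre s d B <= hausdorff_pre s d (A `|` B).
Proof.
move=> de e0 sepAB; apply: le_ereal_inf_tmp => _ [F [ABF Fd] <-].
(* Members missing [C] are replaced by the empty set, whose cost is 0 even when [s] is 0. *)
pose trace C k : set 'rV[R]_n := if `[< F k `&` C !=set0 >] then F k else set0.
have trace_ge C : C `<=` A `|` B ->
    hausdorff_pre s d C <= \sum_(k <oo) diam_pow s (trace C k).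
  move=> CAB; apply: ereal_inf_lbound; exists (trace C) => //; split.
    move=> x Cx; have [k _ Fkx] := ABF _ (CAB _ Cx); exists k => //.
    by rewrite /trace; case: asboolP => // -[]; exists x.
  move=> k; rewrite /trace; case: asboolP => // _.
  by rewrite /ediam setX0 image_set0 ereal_sup0 leNye.
apply: (le_trans (leeD (trace_ge A _) (trace_ge B _))).
- by move=> x; left.
- by move=> x; right.
rewrite -nneseriesD; [|by move=> k _ _; exact: diam_pow_ge0..].
apply: lee_nneseries => [k _ _|k _]; first by apply: adde_ge0; exact: diam_pow_ge0.
have D0 : diam_pow s (set0 : set 'rV[R]_n) = 0 by rewrite /diam_pow eqxx.
rewrite /trace; case: asboolP => [[x [Fx Ax]]|_]; last first.
  by rewrite D0 add0e; case: asboolP => // _; rewrite D0 diam_pow_ge0.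
case: asboolP => [[y [Fy By]]|_]; last by rewrite D0 adde0.
exfalso; apply: (sepAB x y Ax By).
(* [ball] refers to the sup norm, which the Euclidean norm dominates. *)
have xyd : (enorm (x - y) <= d)%R.
  rewrite -lee_fin; apply: le_trans (Fd k).
  by apply: ereal_sup_ubound; exists (x, y).
split=> // i j; rewrite !ord1 /ball/=.
have := coord_le_enorm (x - y) j; rewrite !mxE => /le_lt_trans; apply.
exact: le_lt_trans de.
Qed.

Let hausdorff_const s : R := vol (@unit_ball R s) / 2 ^+ s.

Let hausdorff_const_ge0 s : (0 <= hausdorff_const s)%R.
Proof. by rewrite divr_ge0// fine_ge0// lebesgue_rV_ge0. Qed.

Let hausdorff_sup s (A : set 'rV[R]_n) :=
  ereal_sup [set hausdorff_pre s d A | d in [set d : R | (0 < d)%R]].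

Let hausdorff_sup_ge0 s A : 0 <= hausdorff_sup s A.
Proof.
apply: le_ereal_sup_tmp; exists (hausdorff_pre s 1 A); last exact: hausdorff_pre_ge0.
by exists 1%R => //=; exact: ltr01.
Qed.

Lemma hausdorff_ge0 s (A : set 'rV[R]_n) : 0 <= hausdorff s A.
Proof.
apply: mule_ge0; last exact: hausdorff_sup_ge0.
by rewrite lee_fin; exact: hausdorff_const_ge0.
Qed.

Lemma hausdorff0 s : hausdorff s (set0 : set 'rV[R]_n) = 0.
Proof.
suff sup0 : hausdorff_sup s set0 = 0.
  by rewrite /hausdorff -/(hausdorff_sup s _) sup0 mule0.
apply/eqP; rewrite eq_le hausdorff_sup_ge0 andbT; apply: ge_ereal_sup => _ [d _ <-].
by rewrite hausdorff_pre0.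
Qed.

Lemma le_hausdorff s : {homo @hausdorff R n s : A B / A `<=` B >-> A <= B}.
Proof.
move=> A B AB; apply: lee_wpmul2l.
  by rewrite lee_fin; exact: hausdorff_const_ge0.
apply: ge_ereal_sup => _ [d d0 <-].
apply: le_ereal_sup_tmp; exists (hausdorff_pre s d B); first by exists d.
exact: le_hausdorff_pre.
Qed.

Lemma hausdorff_sigma_subadditive s : sigma_subadditive (@hausdorff R n s).
Proof.
move=> F; rewrite nneseriesZl => [|*]; last exact: hausdorff_sup_ge0.
apply: lee_wpmul2l; first by rewrite lee_fin; exact: hausdorff_const_ge0.
apply: ge_ereal_sup => _ [d d0 <-].
apply: (le_trans (@hausdorff_pre_sigma_subadditive s d F)).
apply: lee_nneseries => [*|k _]; first exact: hausdorff_pre_ge0.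
by apply: ereal_sup_ubound; exists d.
Qed.

HB.instance Definition _ s := isOuterMeasure.Build R 'rV[R]_n (@hausdorff R n s)
  (hausdorff0 s) (hausdorff_ge0 s) (@le_hausdorff s)
  (@hausdorff_sigma_subadditive s).

Lemma hausdorff_separated s (A B : set 'rV[R]_n) (e : R) : (0 < e)%R ->
  (forall x y, A x -> B y -> ~ ball x e y) ->
  hausdorff s A + hausdorff s B <= hausdorff s (A `|` B).
Proof.
move=> e0 sepAB.
rewrite -ge0_muleDr ?hausdorff_sup_ge0//; apply: lee_wpmul2l.
  by rewrite lee_fin; exact: hausdorff_const_ge0.
apply: ereal_sup_add_le.
- by exists (hausdorff_pre s 1 A); exists 1%R => //=; exact: ltr01.
- by exists (hausdorff_pre s 1 B); exists 1%R => //=; exact: ltr01.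
- by move=> _ [d _ <-]; exact: hausdorff_pre_ge0.
- by move=> _ [d _ <-]; exact: hausdorff_pre_ge0.
move=> _ _ [d /= d0 <-] [d' /= d'0 <-].
(* Shrinking the scale only increases the premeasure, so [d] and [d'] may be replaced by a common
   scale, taken below [e] for separation. *)
pose r : R := Num.min (Num.min d d') (e / 2)%R.
have r0 : (0 < r)%R by rewrite !lt_min d0 d'0 divr_gt0.
apply: (@le_trans _ _ (hausdorff_pre s r A + hausdorff_pre s r B)).
  by apply: leeD; apply: hausdorff_pre_antitone; rewrite !ge_min lexx ?orbT.
apply: (le_trans (hausdorff_pre_separated _ _ e0 sepAB)).
  by rewrite gt_min ltr_pdivrMr// ltr_pMr// ltr1n orbT.
by apply: ereal_sup_ubound; exists r.
Qed.

(** The Caratheodory measurable sets form a sigma-algebra containing the open sets, hence all Borel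
    sets. *)
Lemma hausdorff_caratheodory s (A : set (borel R n)) :
  measurable A -> (@hausdorff R n s).-caratheodory A.
Proof.
apply: smallest_sub; last first.
  by move=> U oU; apply: metric_outer_measure_open => //; exact: hausdorff_separated.
exact: (sigma_algebra_measurable (caratheodory_type (@hausdorff R n s))).
Qed.

End hausdorff_outer_measure.

(** * The spherical measure as a measure on the Borel sets *)

Section spherical_measure.
Context (R : realType) (n : nat).

Lemma dot_continuous (u : 'rV[R]_n) : continuous (dot u).
Proof.
apply: continuous_big => [|i _ x].
  exact: (@pseudometric_normed_Zmodule.add_continuous R R).
apply: (@continuousM R 'rV[R]_n (fun=> u ord0 i) (fun x => x ord0 i)).
  exact: cst_continuous.
exact: coord_continuous.
Qed.

Lemma dotC (x y : 'rV[R]_n) : dot x y = dot y x.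
Proof. by apply: eq_bigr => i _; rewrite mulrC. Qed.

Lemma measurable_open (U : set (borel R n)) :
  open (U : set 'rV[R]_n) -> measurable U.
Proof. exact: sub_sigma_algebra. Qed.

Lemma measurable_sphere : measurable (@sphere R n : set (borel R n)).
Proof.
have -> : @sphere R n = ~` [set x | dot x x != 1].
  apply/seteqP; split=> x; rewrite /sphere /= /enorm.
    have x0 : 0 <= dot x x by apply: sumr_ge0 => i _; rewrite -expr2 sqr_ge0.
    by move=> x1; apply/negP/negPn; rewrite -(sqr_sqrtr x0) x1 expr1n.
  by move=> /negP/negPn/eqP ->; rewrite sqrtr1.
apply: measurableC; apply: measurable_open.
apply: (@open_comp _ _ (fun x : 'rV[R]_n => dot x x) [set y : R | y != 1]).
  move=> x _; apply: continuous_big => [|i _ {}x].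
    exact: (@pseudometric_normed_Zmodule.add_continuous R R).
  by apply: (@continuousM R 'rV[R]_n (fun x => x ord0 i) (fun x => x ord0 i));
    exact: coord_continuous.
exact: open_neq.
Qed.

Lemma spherical_measure0 : @spherical_measure R n set0 = 0%E.
Proof. by rewrite /spherical_measure set0I hausdorff0. Qed.

Lemma spherical_measure_ge0 (A : set (borel R n)) :
  (0 <= @spherical_measure R n A)%E.
Proof. exact: hausdorff_ge0. Qed.

Lemma spherical_measure_sigma_additive :
  semi_sigma_additive (@spherical_measure R n).
Proof.
move=> F mF tF mUF; rewrite /spherical_measure setI_bigcupl.
have mFS i : measurable (F i `&` @sphere R n : set (borel R n)).
  by apply: measurableI; [exact: mF|exact: measurable_sphere].
apply: (@caratheodory_measure_sigma_additive _ _ (@hausdorff R n n.-1)).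
- by move=> i; exact: hausdorff_caratheodory.
- exact: trivIset_setIr.
- apply: hausdorff_caratheodory; exact: bigcup_measurable.
Qed.

HB.instance Definition _ := isMeasure.Build _ _ _ (@spherical_measure R n)
  spherical_measure0 spherical_measure_ge0 spherical_measure_sigma_additive.

End spherical_measure.

(** * Hoelder's inequality for several functions *)

Section ereal_products.
Context (R : realType).
Local Open Scope ereal_scope.

Lemma expe_prod (x : \bar R) m : x ^+ m = \prod_(i < m) x.
Proof.
elim: m => [|m IH]; first by rewrite big_ord0 expe0.
by rewrite expeS big_ord_recl IH.
Qed.

Lemma lee_prod (I : finType) (f g : I -> \bar R) :
  (forall i, 0 <= f i) -> (forall i, f i <= g i) ->
  \prod_i f i <= \prod_i g i.
Proof.
move=> f0 fg; suff /andP[] : 0 <= \prod_i f i <= \prod_i g i by [].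
elim/big_ind2: _ => [|x y z t /andP[x0 xy] /andP[z0 zt]|i _].
- by rewrite lee01 lexx.
- by rewrite mule_ge0//= lee_pmul.
- by rewrite f0 fg.
Qed.

Lemma lee_expe (x y : \bar R) m : 0 <= x -> x <= y -> x ^+ m <= y ^+ m.
Proof. by move=> x0 xy; rewrite !expe_prod; exact: lee_prod. Qed.

Lemma poweR_prod (I : finType) (f : I -> \bar R) (a : R) :
  (forall i, 0 <= f i) -> (\prod_i f i) `^ a = \prod_i (f i `^ a).
Proof.
move=> f0.
suff [] : 0 <= \prod_i f i /\ (\prod_i f i) `^ a = \prod_i (f i `^ a) by [].
elim/big_rec2: _ => [|i x y _ [y0 IH]]; first by rewrite poweR1r lee01.
by rewrite mule_ge0//= poweRM// IH.
Qed.

Lemma le_poweR (x y : \bar R) (r : R) : (0 <= r)%R -> 0 <= x -> x <= y ->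
  x `^ r <= y `^ r.
Proof.
move=> r0 x0 xy; apply: gt0_ler_poweR => //.
  by rewrite in_itv/= x0 leey.
by rewrite in_itv/= leey (le_trans x0 xy).
Qed.

Lemma expe_poweR (x : \bar R) m : (0 < m)%N -> 0 <= x -> x ^+ m = x `^ m%:R.
Proof.
move=> m0; case: x => [r| |]//.
  by rewrite lee_fin => r0; rewrite poweR_EFin powR_mulrn// EFin_expe.
move=> _; rewrite poweRyr ?pnatr_eq0 -?lt0n//.
by case: m m0 => // m _; elim: m => [|m IH]; rewrite expeS ?expe0 ?mule1// IH mulyy.
Qed.

(** Taking m-th roots turns the hypothesis into a fixed upper bound for the elements of [S], which
    passes to the supremum. *)
Lemma ereal_sup_expe_le (S : set \bar R) (m : nat) (z : \bar R) : (0 < m)%N ->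
  S !=set0 -> (forall x, S x -> 0 <= x) -> (forall x, S x -> x ^+ m <= z) ->
  (ereal_sup S) ^+ m <= z.
Proof.
move=> m0 [x0 Sx0] S0 Sz.
have z0 : 0 <= z by apply: le_trans (Sz _ Sx0); apply/expe_ge0/S0.
have m0R : (m%:R != 0 :> R)%R by rewrite pnatr_eq0 -lt0n.
have sup0 : 0 <= ereal_sup S by apply: le_ereal_sup_tmp; exists x0; rewrite ?S0.
have rootK (y : \bar R) : 0 <= y -> (y `^ m%:R) `^ m%:R^-1 = y.
  by move=> y0; rewrite -poweRrM mulfV// poweRe1.
apply: (@le_trans _ _ ((z `^ m%:R^-1) ^+ m)).
  apply: lee_expe => //; apply: ge_ereal_sup => x Sx.
  rewrite -(rootK x) ?S0//; apply: le_poweR; rewrite ?invr_ge0 ?poweR_ge0//.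
  by rewrite -expe_poweR ?S0// Sz.
by rewrite expe_poweR ?poweR_ge0// poweRAC rootK.
Qed.

Lemma expe_mul_prod (x : \bar R) (m : nat) (f : 'I_m -> \bar R) (c : R) :
  (0 <= c)%R -> x ^+ m <= \prod_i f i ->
  (c%:E * x) ^+ m <= \prod_i (c%:E * f i).
Proof.
move=> c0 xf; rewrite big_split/= expe_prod big_split/= -!expe_prod.
by apply: lee_wpmul2l => //; apply: expe_ge0; rewrite lee_fin.
Qed.

End ereal_products.

Section generalized_hoelder.
Context d (T : measurableType d) (R : realType).
Variable mu : {measure set T -> \bar R}.
Local Open Scope ereal_scope.

(** Hoelder's inequality with equal exponents, in a root-free form. After the degenerate cases, each
    [f i] is divided by its integral and the inequality of arithmetic and geometric means is applied
    pointwise. *)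
Lemma hoelder_prod (D : set T) (m : nat) (F : T -> R) (f : 'I_m -> T -> R) :
  measurable D -> (0 < m)%N ->
  measurable_fun D F -> (forall i, measurable_fun D (f i)) ->
  (forall x, D x -> (0 <= F x)%R) -> (forall i x, D x -> (0 <= f i x)%R) ->
  (forall x, D x -> (F x ^+ m <= \prod_i f i x)%R) ->
  (\int[mu]_(x in D) (F x)%:E) ^+ m <= \prod_i \int[mu]_(x in D) (f i x)%:E.
Proof.
move=> mD m0 mF mf F0 f0 Ff.
pose I i := \int[mu]_(x in D) (f i x)%:E.
have I0 i : 0 <= I i by apply: integral_ge0 => x Dx; rewrite lee_fin f0.
have IF0 : 0 <= \int[mu]_(x in D) (F x)%:E.
  by apply: integral_ge0 => x Dx; rewrite lee_fin F0.
have mEF : measurable_fun D (fun x => (F x)%:E) by exact/measurable_EFinP.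
have mEf i : measurable_fun D (fun x => (f i x)%:E) by exact/measurable_EFinP.
(* A zero integral makes [f i], hence [F], vanish almost everywhere. This case precedes the infinite
   one because 0 times infinity is 0. *)
have [[i Ii0]|/forallNP Ineq0] := pselect (exists i, I i = 0).
  suff -> : \int[mu]_(x in D) (F x)%:E = 0.
    rewrite expe_prod (bigD1 (Ordinal m0))//= mul0e.
    by apply: prode_ge0 => j _; exact: I0.
  apply/eqP; rewrite eq_le IF0 andbT.
  have fi0 : ae_eq mu D (fun x => (f i x)%:E) (cst 0).
    apply/ae_eq_integral_abs => //; rewrite -[RHS]Ii0.
    by apply: eq_integral => x /set_mem Dx /=; rewrite ger0_norm// f0.
  rewrite -[leRHS](integral0 mu D).
  apply: ae_ge0_le_integral => //.
  have : \forall x \ae mu, D x -> (f i x)%:E = 0 by [].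
  apply: filterS => x /= fx0 Dx; have [fx] := fx0 Dx.
  have := Ff x Dx; rewrite (bigD1 i)//= fx mul0r lee_fin => /= Fm.
  have : (F x ^+ m == 0)%R by rewrite eq_le Fm exprn_ge0// F0.
  by rewrite expf_eq0 m0 => /eqP ->.
have Igt0 i : 0 < I i by rewrite lt0e I0 andbT; apply/eqP; exact: Ineq0.
have [[i Iioo]|/forallNP Ineqy] := pselect (exists i, I i = +oo).
  rewrite [leRHS](bigD1 i)//= -/(I i) Iioo gt0_mulye ?leey//.
  elim/big_ind: _ => [|x y|j _]; [exact: lte01|exact: mule_gt0|exact: Igt0].
pose c i := fine (I i).
have cE i : I i = (c i)%:E.
  by rewrite /c fineK// ge0_fin_numE// ltey; apply/eqP; exact: Ineqy.
have c0 i : (0 < c i)%R by rewrite -lte_fin -cE.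
pose C := (\prod_i c i)%R; pose r := (C `^ m%:R^-1)%R.
have C0 : (0 < C)%R by apply: prodr_gt0.
have rm : (r ^+ m = C)%R.
  rewrite -powR_mulrn ?powR_ge0// -powRrM mulVf ?powRr1 ?ltW//.
  by rewrite pnatr_eq0 -lt0n.
have r0 : (0 <= r)%R by exact: powR_ge0.
(* With these weights the sum of the [k i * f i] is [r] times the mean of the normalized functions.
   It dominates [F] pointwise, and each of its [m] terms integrates to [r / m]. *)
pose k i := (r / m%:R / c i)%R.
have k0 i : (0 <= k i)%R by rewrite !divr_ge0// ltW.
suff F_le : \int[mu]_(x in D) (F x)%:E <= r%:E.
  apply: (@le_trans _ _ (r%:E ^+ m)); first exact: lee_expe.
  rewrite -EFin_expe rm -prodEFin le_eqVlt; apply/orP; left; apply/eqP.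
  by apply: eq_bigr => i _; rewrite -cE.
apply: (@le_trans _ _ (\int[mu]_(x in D) \sum_i ((k i)%:E * (f i x)%:E))).
  apply: ge0_le_integral => //.
    apply: emeasurable_sum => i; apply: measurable_funeM; exact: mEf.
  move=> x Dx.
  under eq_bigr do rewrite -EFinM.
  rewrite sumEFin lee_fin -(@ler_pXn2r _ m)// ?nnegrE ?F0//; last first.
    by apply: sumr_ge0 => i _; rewrite mulr_ge0// f0.
  apply: (le_trans (Ff x Dx)).
  have := @leif_AGM R 'I_m predT (fun i => f i x / c i)%R.
  rewrite /= cardT size_enum_ord => /(_ _)[|+ _].
    by move=> i _; rewrite divr_ge0 ?f0// ltW.
  rewrite -(ler_pM2l C0) -{2}rm -exprMn => AGM.
  have -> : (\prod_i f i x = C * \prod_(i in 'I_m) (f i x / c i))%R.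
    by rewrite -big_split/=; apply: eq_bigr => i _; rewrite mulrC divfK// gt_eqF.
  apply: (le_trans AGM); rewrite le_eqVlt; apply/orP; left; apply/eqP.
  congr (_ ^+ _)%R; rewrite mulrA mulrAC mulr_sumr; apply: eq_bigr => i _.
  by rewrite /k; ring.
rewrite ge0_integral_sum//; last 2 first.
- by move=> i; apply: measurable_funeM; exact: mEf.
- by move=> i x Dx; rewrite mule_ge0// lee_fin// f0.
rewrite (eq_bigr (fun=> (r / m%:R)%:E)) => [|i _]; last first.
  rewrite ge0_integralZl_EFin//; last by move=> x Dx; rewrite lee_fin f0.
  by rewrite -/(I i) cE -EFinM divfK// gt_eqF.
rewrite sumEFin lee_fin sumr_const card_ord -[leLHS]mulr_natr divfK//.
by rewrite pnatr_eq0 -lt0n.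
Qed.

End generalized_hoelder.

(** * Integration against a density *)

Section integral_density.
Context d (T : measurableType d) (R : realType).
Variables (mu : {measure set T -> \bar R}) (nu : set T -> \bar R).
Variables (D : set T) (f g : T -> R).
Hypotheses (mD : measurable D).
Hypotheses (mf : measurable_fun D f) (f0 : forall x, D x -> 0 <= f x).
Hypothesis nuE : forall A, measurable A -> A `<=` D ->
  nu A = (\int[mu]_(x in A) (f x)%:E)%E.
Local Open Scope ereal_scope.
Import HBNNSimple.

Let nu0 : nu set0 = 0.
Proof. by rewrite nuE// integral_set0. Qed.

Let mEf : measurable_fun D (fun x => (f x)%:E).
Proof. exact/measurable_EFinP. Qed.

(** Vanishing off [D] puts every level set of a nonzero value inside [D], where [nuE] applies. The
    level set of 0 may leave [D], but its measure is multiplied by 0. *)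
Let sintegral_density (h : {nnsfun T >-> R}) :
  (forall x, ~ D x -> h x = 0%R) ->
  sintegral nu h = \int[mu]_(x in D) (h x * f x)%:E.
Proof.
move=> hD.
have mA r : measurable (h @^-1` [set r]) by [].
have fE x : (h x * f x)%:E =
    \sum_(r \in range h) (r * (\1_(h @^-1` [set r]) x * f x))%:E.
  rewrite fsumEFin// fimfunE.
  rewrite [in LHS]mulrC mulr_fsumr; congr (_%:E); apply: eq_fsbigr => r _.
  by rewrite mulrC mulrA.
under [RHS]eq_integral do rewrite fE.
rewrite ge0_integral_fsum//; last 2 first.
- by move=> r; apply/measurable_EFinP; do 2 (apply: measurable_funM => //).
- move=> r x Dx; rewrite lee_fin; rewrite indicE.
  have [|xr] := boolP (x \in _); last by rewrite mul0r mulr0.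
  by rewrite inE /= => <-; rewrite mul1r mulr_ge0// f0.
rewrite /sintegral -[LHS](fsbig_widen (range h) setT)//=; last first.
  by move=> x [_ Nhx] /=; rewrite preimage10// nu0 mule0.
apply: eq_fsbigr => r /set_mem [x _ hxr].
have [->|r0] := eqVneq r 0%R.
  by rewrite mul0e integral0_eq// => y _; rewrite mul0r.
have AD : h @^-1` [set r] `<=` D.
  by move=> y /= hyr; apply: contrapT => /hD hy0; move: r0; rewrite -hyr hy0 eqxx.
rewrite nuE// -[in LHS](setIidr AD) integral_mkcondr.
under [RHS]eq_integral do rewrite EFinM.
rewrite ge0_integralZl_EFin//.
- congr (_ * _); apply: eq_integral => y _; rewrite patchE indicE.
  by case: ifP => _; rewrite ?mul1r ?mul0r.
- by move=> y Dy; rewrite lee_fin mulr_ge0// f0.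
- by apply/measurable_EFinP; apply: measurable_funM.
- by rewrite -hxr.
Qed.

(** [nu] is a bare set function, so its integral is treated through its definition by suprema over
    simple functions. Simple functions below [g] and vanishing off [D] give lower bounds, and
    monotone convergence for [mu] carries these up to [g]. *)
Lemma le_integral_density : measurable_fun D g ->
  (forall x, D x -> (0 <= g x)%R) ->
  \int[mu]_(x in D) (g x * f x)%:E <= \int[nu]_(x in D) (g x)%:E.
Proof.
move=> mg g0.
have mEg : measurable_fun D (fun x => (g x)%:E) by exact/measurable_EFinP.
have Eg0 x : D x -> 0 <= (g x)%:E by move=> Dx; rewrite lee_fin g0.
have le_int (h : {nnsfun T >-> R}) : (forall x, ~ D x -> h x = 0%R) ->
    (forall x, D x -> (h x <= g x)%R) ->
    sintegral nu h <= \int[nu]_(x in D) (g x)%:E.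
  move=> hD hg; rewrite /integral funeneg_restrict funepos_restrict.
  have /eq_restrictP-> := ge0_funeposE Eg0.
  have /eq_restrictP-> := ge0_funenegE Eg0.
  rewrite erestrict0.
  (* The negative part of [g] contributes 0: a simple function below 0 is zero, and
     [sintegral_density] evaluates its integral. *)
  have -> : ereal_sup [set sintegral nu h0 | h0 in
      [set h0 : {nnsfun T >-> R} | forall x, (h0 x)%:E <= cst 0 x]] = 0.
    suff -> : [set sintegral nu h0 | h0 in
      [set h0 : {nnsfun T >-> R} | forall x, (h0 x)%:E <= cst 0 x]] = [set 0].
      exact: ereal_sup1.
    have s0 (h0 : {nnsfun T >-> R}) : (forall x, (h0 x)%:E <= cst 0 x) ->
        sintegral nu h0 = 0.
      move=> h00; rewrite sintegral_density => [|x _].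
        by rewrite integral0_eq// => x _; rewrite (_ : h0 x = 0%R) ?mul0r//;
          apply/eqP; rewrite eq_le -lee_fin h00 fun_ge0.
      by apply/eqP; rewrite eq_le -lee_fin h00 fun_ge0.
    apply/seteqP; split=> [_ [h0 /= h00 <-]|_ ->]; first exact: s0.
    by exists nnsfun0 => //; apply: s0 => x.
  rewrite sube0; apply: ereal_sup_ubound; exists h => // x /=.
  rewrite patchE; case: ifPn => [/set_mem Dx|/negP xD]; first by rewrite lee_fin hg.
  by rewrite hD// => Dx; apply: xD; rewrite inE.
pose a n := nnsfun_approx mD mEg n.
have a_cvg x : D x -> (a n x)%:E @[n --> \oo] --> (g x)%:E.
  by move=> Dx; exact: cvg_nnsfun_approx.
have a_nd : nondecreasing_seq (fun n => a n : T -> R) by exact: nd_nnsfun_approx.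
have a_nd' x : nondecreasing_seq (fun n => a n x).
  by move=> i j ij; have /lefP := a_nd i j ij; exact.
have a_le n x : D x -> (a n x <= g x)%R.
  move=> Dx; rewrite -lee_fin -(cvg_lim _ (a_cvg x Dx))//.
  apply: lime_ge; first by apply/cvg_ex; exists (g x)%:E; exact: a_cvg.
  by near=> k; rewrite lee_fin a_nd'//; near: k; exact: nbhs_infty_ge.
have step n : \int[mu]_(x in D) (a n x * f x)%:E <= \int[nu]_(x in D) (g x)%:E.
  (* The approximations are cut off outside [D] without changing the integral over [D]. *)
  rewrite (eq_integral (fun x => (proj_nnsfun (a n) mD x * f x)%:E)); last first.
    by move=> x xD /=; rewrite mindicE xD mulr1.
  rewrite -sintegral_density; last first.
    by move=> x Dx /=; rewrite mindicE memNset// mulr0.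
  apply: le_int => x Dx /=; first by rewrite mindicE memNset// mulr0.
  by rewrite mindicE mem_set// mulr1 a_le.
have af_cvg : (\int[mu]_(x in D) (a n x * f x)%:E) @[n --> \oo] -->
    \int[mu]_(x in D) (lim ((a n x * f x)%:E @[n --> \oo])).
  apply: cvg_monotone_convergence => //.
  - move=> n; apply/measurable_EFinP; apply: measurable_funM => //.
    exact: measurable_funTS.
  - by move=> n x Dx; rewrite lee_fin mulr_ge0// f0.
  - by move=> x Dx i j ij; rewrite lee_fin ler_wpM2r ?f0// a_nd'.
rewrite (eq_integral (fun x => lim ((a n x * f x)%:E @[n --> \oo]))); last first.
  move=> x /set_mem Dx; apply/esym/cvg_lim => //.
  under eq_fun do rewrite EFinM muleC.
  by rewrite EFinM muleC; apply: cvgeZl => //; exact: a_cvg.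
rewrite -(cvg_lim _ af_cvg)//; apply: lime_le.
  by apply/cvg_ex; eexists; exact: af_cvg.
by apply: nearW => n; exact: step.
Unshelve. all: by end_near. Qed.

End integral_density.

(** * Support and curvature functions *)

Section tail_family.
Context (n m : nat) (hmn : (m <= n)%N).

Definition tail_family (X : Type) (a : 'I_n -> X) (i : 'I_m) : 'I_n -> X :=
  fun j => if (j < n - m)%N then a j else a (rev_ord (widen_ord hmn i)).

Lemma prod_tail (A : comNzRingType) (a : 'I_n -> A) :
  \prod_(j < n | ~~ (j < n - m)%N) a j =
  \prod_(i < m) a (rev_ord (widen_ord hmn i)).
Proof.
(* The inverse reindexing uses [inord], whose target must be nonempty, so an empty tail is split
   off. *)
case: m hmn => [|k] hk.
  by rewrite big_ord0 big_pred0// => j; rewrite subn0 ltn_ord.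
rewrite (reindex_onto (fun i => rev_ord (widen_ord hk i))
  (fun j => inord (n - j.+1))) /=; last first.
  move=> j; rewrite -leqNgt => jm; apply: val_inj => /=.
  rewrite inordK; have := ltn_ord j; first by rewrite subnSK// subKn// ltnW.
  by move: jm hk; rewrite leq_subLR; lia.
apply: eq_bigl => i; have ik := ltn_ord i.
apply/andP; split; first by rewrite -leqNgt; lia.
by apply/eqP/val_inj; rewrite /= inordK; lia.
Qed.

(** On the right, each of the first n-m entries occurs once in each of the [m] families, and each
    later entry occurs [m] times in its own family. This one count serves both the integrands and
    the polar volumes. *)
Lemma prod_tail_family (A : comNzRingType) (a : 'I_n -> A) :
  (\prod_j a j) ^+ m = \prod_i \prod_j tail_family a i j.
Proof.
have tailE i : \prod_j tail_family a i j =
    \prod_(j < n | (j < n - m)%N) a j * a (rev_ord (widen_ord hmn i)) ^+ m.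
  rewrite (bigID (fun j : 'I_n => (j < n - m)%N))/=; congr (_ * _).
    by apply: eq_bigr => j; rewrite /tail_family => ->.
  transitivity (\prod_(j < n | ~~ (j < n - m)%N) a (rev_ord (widen_ord hmn i))).
    by apply: eq_bigr => j /negbTE jm; rewrite /tail_family jm.
  by rewrite (prod_tail (fun=> _)) prodr_const card_ord.
under [RHS]eq_bigr do rewrite tailE.
rewrite big_split/= prodr_const card_ord prodrXl -exprMn -prod_tail.
by congr (_ ^+ _); rewrite [LHS](bigID (fun j : 'I_n => (j < n - m)%N)).
Qed.

End tail_family.

Lemma measurable_fun_powR d (T : measurableType d) (R : realType) (D : set T)
  (f : T -> R) (r : R) :
  measurable_fun D f -> measurable_fun D (fun x => f x `^ r).
Proof. exact: (measurableT_comp (measurable_powR r)). Qed.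

Section support_function.
Context (R : realType) (n : nat).
Implicit Type K : set 'rV[R]_n.

Lemma has_sup_support K u : K0 K -> has_sup [set dot x u | x in K].
Proof.
move=> [cK _ K0]; split.
  by exists (dot 0 u); exists 0 => //; exact: interior_subset.
have -> : [set dot x u | x in K] = dot u @` K.
  by apply/seteqP; split=> _ [x Kx <-]; exists x => //; exact: dotC.
have /compact_bounded [M [_ HM]] : compact (dot u @` K).
  apply: continuous_compact => //; apply: continuous_subspaceT.
  exact: dot_continuous.
exists (M + 1) => y Ky; apply: le_trans (ler_norm y) _.
by apply: (HM (M + 1)) => //; rewrite ltrDl.
Qed.

(** A supremum of continuous functions is lower semicontinuous: its strict superlevel sets are
    unions of open sets. *)
Lemma measurable_support_function K (D : set (borel R n)) : K0 K ->
  measurable_fun D (support_function K : borel R n -> R).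
Proof.
move=> kK; apply: measurable_funTS.
apply: (measurability _ (RGenOInfty.measurableE R)) => _ [_ [r ->] <-].
rewrite setTI; apply: measurable_open.
have -> : support_function K @^-1` `]r, +oo[ =
    \bigcup_(x in K) (dot x @^-1` [set y : R | r < y]).
  apply/seteqP; split=> u /=; rewrite in_itv/= andbT.
    move=> ru; have [_ [x Kx <-] rx] := sup_gt (has_sup_support u kK).1 ru.
    by exists x.
  move=> [x Kx /= rx]; apply: lt_le_trans rx _.
  by apply: ub_le_sup; [exact: (has_sup_support u kK).2|exists x].
apply: bigcup_open => x _; apply: open_comp; last exact: open_gt.
by move=> u _; exact: dot_continuous.
Qed.

Lemma curvatureP K : F0 K -> is_curvature_function K (curvature K).
Proof. by case=> _ _ ?; exact: xgetPex. Qed.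

Section mixed_density.
Variables (p : R) (K L : set 'rV[R]_n).
Hypotheses (hK : F0 K) (hL : K0 L).

Definition lp_density (u : borel R n) : R :=
  support_function L u `^ p * curvature_p p K u.

Lemma lp_density_ge0 u : @sphere R n u -> 0 <= lp_density u.
Proof.
move=> Su; rewrite !mulr_ge0 ?powR_ge0//.
by have [_ + _] := curvatureP hK; exact.
Qed.

Lemma measurable_lp_density : 
  measurable_fun (@sphere R n : set (borel R n)) lp_density.
Proof.
have [kK _ _] := hK; have [mc _ _] := curvatureP hK.
apply: measurable_funM.
  by apply: measurable_fun_powR; exact: measurable_support_function.
apply: measurable_funM => //.
by apply: measurable_fun_powR; exact: measurable_support_function.
Qed.

(** The curvature function is the density of the surface area measure, and the remaining factor
    h_L^p h_K^(1-p) is the integrand of [Vp]. *)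
Lemma integral_lp_density_le_Vp :
  (((n%:R^-1)%:E * \int[@spherical_measure R n]_(u in @sphere R n)
     (lp_density u)%:E) <= Vp p K L)%E.
Proof.
have [kK _ _] := hK; have [mc c0 SE] := curvatureP hK.
apply: lee_wpmul2l; first by rewrite lee_fin invr_ge0.
rewrite /lp_density /curvature_p.
under eq_integral do rewrite mulrA.
apply: (@le_integral_density _ _ _ (@spherical_measure R n)) => //.
- exact: measurable_sphere.
- by apply: measurable_funM; apply: measurable_fun_powR;
    exact: measurable_support_function.
- by move=> u Su; rewrite mulr_ge0 ?powR_ge0.
Qed.

End mixed_density.
End support_function.

(** * The inequality for geominimal surface areas *)

Section mixed_geominimal.
Context (R : realType) (n : nat) (p : R).
Hypotheses (hp : - n%:R < p < 0).
Implicit Types K L : 'I_n -> set 'rV[R]_n.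

Let n_gt0 : (0 < n)%N.
Proof.
rewrite lt0n; apply/eqP => n0; move: hp; rewrite n0 oppr0 => /andP[p0 p0'].
by have := lt_trans p0 p0'; rewrite ltxx.
Qed.

Let np_gt0 : 0 < n%:R + p.
Proof. by case/andP: hp => + _; rewrite -subr_gt0 opprK addrC. Qed.

Let n_neq0 : n%:R != 0 :> R.
Proof. by rewrite pnatr_eq0 -lt0n. Qed.

Definition mixed_density K L (u : borel R n) : R :=
  \prod_(j < n) lp_density p (K j) (L j) u `^ n%:R^-1.

Let mixed_density_ge0 K L u : 0 <= mixed_density K L u.
Proof. by apply: prodr_ge0 => j _; exact: powR_ge0. Qed.

Let measurable_mixed_density K L :
  (forall j, F0 (K j)) -> (forall j, K0 (L j)) ->
  measurable_fun (@sphere R n : set (borel R n)) (mixed_density K L).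
Proof.
move=> hK hL; apply: measurable_prod => j _; apply: measurable_fun_powR.
exact: measurable_lp_density.
Qed.

Lemma mixed_Vp_ge0 K L : (0 <= mixed_Vp p K L)%E.
Proof.
apply: mule_ge0; first by rewrite lee_fin invr_ge0.
by apply: integral_ge0 => u _; rewrite lee_fin; exact: mixed_density_ge0.
Qed.

Lemma Vp_ge0 (K L : set 'rV[R]_n) : F0 K -> K0 L -> (0 <= Vp p K L)%E.
Proof.
move=> hK hL; apply: le_trans (integral_lp_density_le_Vp p hK hL).
apply: mule_ge0; first by rewrite lee_fin invr_ge0.
by apply: integral_ge0 => u Su; rewrite lee_fin; exact: lp_density_ge0.
Qed.

Lemma mixed_Vp_expe_le m (hmn : (m <= n)%N) K L : (0 < m)%N ->
  (forall j, F0 (K j)) -> (forall j, K0 (L j)) ->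
  (mixed_Vp p K L ^+ m <=
   \prod_(i < m) mixed_Vp p (tail_family hmn K i) (tail_family hmn L i))%E.
Proof.
move=> m0 hK hL; apply: expe_mul_prod; first by rewrite invr_ge0.
apply: (@hoelder_prod _ _ _ (@spherical_measure R n) _ m (mixed_density K L)
  (fun i => mixed_density (tail_family hmn K i) (tail_family hmn L i))) => //.
- exact: measurable_sphere.
- exact: measurable_mixed_density.
- by move=> i; apply: measurable_mixed_density => j; rewrite /tail_family;
    case: ifP.
(* Pointwise, the bound required by Hoelder's inequality is an equality. *)
move=> u Su; rewrite /mixed_density (prod_tail_family hmn) le_eqVlt; apply/orP; left.
apply/eqP; apply: eq_bigr => i _; apply: eq_bigr => j _.
by rewrite /tail_family; case: ifP.
Qed.

Lemma mixed_Vp_expe_le_Vp K L :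
  (forall j, F0 (K j)) -> (forall j, K0 (L j)) ->
  (mixed_Vp p K L ^+ n <= \prod_(i < n) Vp p (K i) (L i))%E.
Proof.
move=> hK hL.
apply: (@le_trans _ _ (\prod_(i < n) ((n%:R^-1)%:E *
  \int[@spherical_measure R n]_(u in @sphere R n)
    (lp_density p (K i) (L i) u)%:E))%E); last first.
  apply: lee_prod => i; last exact: integral_lp_density_le_Vp.
  apply: mule_ge0; first by rewrite lee_fin invr_ge0.
  by apply: integral_ge0 => u Su; rewrite lee_fin; exact: lp_density_ge0.
apply: expe_mul_prod; first by rewrite invr_ge0.
apply: (@hoelder_prod _ _ _ (@spherical_measure R n) _ n (mixed_density K L)
  (fun i => lp_density p (K i) (L i))) => //.
- exact: measurable_sphere.
- exact: measurable_mixed_density.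
- by move=> i; exact: measurable_lp_density.
- by move=> i u Su; exact: lp_density_ge0.
(* The n-th power cancels the n-th roots, again with equality. *)
move=> u Su; rewrite /mixed_density -prodrXl le_eqVlt; apply/orP; left.
apply/eqP; apply: eq_bigr => i _; rewrite -powR_mulrn ?powR_ge0//.
by rewrite -powRrM mulVf// powRr1// lp_density_ge0.
Qed.

Definition polar_weight L : R :=
  \prod_(j < n) vol (polar (L j)) `^ (p / ((n%:R + p) * n%:R)).

(** Common form of the quantities under all three suprema, with the volume and the polar factor kept
    apart so that they can be compared independently. *)
Definition geominimal_value (V : \bar R) (w : R) : \bar R :=
  (n%:R%:E * V `^ (n%:R / (n%:R + p)) * w%:E)%E.

Lemma geominimal_value_ge0 V w : 0 <= w -> (0 <= geominimal_value V w)%E.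
Proof. by move=> w0; rewrite !mule_ge0 ?poweR_ge0 ?lee_fin. Qed.

(** The exponent n/(n+p) is positive, so the bound on [V] survives the power, while the polar
    factors agree exactly. *)
Lemma geominimal_value_expe_le m (V : \bar R) (w : R)
    (V' : 'I_m -> \bar R) (w' : 'I_m -> R) :
  (0 <= V)%E -> 0 <= w -> (forall i, 0 <= V' i)%E ->
  (V ^+ m <= \prod_i V' i)%E -> w ^+ m = \prod_i w' i ->
  (geominimal_value V w ^+ m <= \prod_i geominimal_value (V' i) (w' i))%E.
Proof.
move=> V0 w0 V'0 VV' ww'; rewrite expe_prod /geominimal_value !big_split/=.
rewrite -!expe_prod -!EFin_expe prodEFin ww'.
apply: lee_wpmul2r; first by rewrite lee_fin -ww' exprn_ge0.
apply: lee_wpmul2l; first by rewrite lee_fin exprn_ge0.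
have a0 : 0 <= n%:R / (n%:R + p) by rewrite divr_ge0// ltW.
rewrite -poweR_prod// expe_prod -poweR_prod// -expe_prod.
by apply: le_poweR => //; exact: expe_ge0.
Qed.

Lemma polar_weight_ge0 L : 0 <= polar_weight L.
Proof. by apply: prodr_ge0 => j _; exact: powR_ge0. Qed.

Lemma polar_weight_tail m (hmn : (m <= n)%N) L :
  polar_weight L ^+ m = \prod_i polar_weight (tail_family hmn L i).
Proof.
rewrite /polar_weight (prod_tail_family hmn); apply: eq_bigr => i _.
by apply: eq_bigr => j _; rewrite /tail_family; case: ifP.
Qed.

Let weight_rootK (x : R) :
  (x `^ (p / ((n%:R + p) * n%:R))) ^+ n = x `^ (p / (n%:R + p)).
Proof.
rewrite -powR_mulrn ?powR_ge0// -powRrM; congr (_ `^ _).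
by field; rewrite n_neq0 gt_eqF.
Qed.

Lemma polar_weight_cst (M : set 'rV[R]_n) :
  polar_weight (fun=> M) = vol (polar M) `^ (p / (n%:R + p)).
Proof. by rewrite /polar_weight prodr_const card_ord weight_rootK. Qed.

Lemma polar_weight_expn L :
  polar_weight L ^+ n = \prod_i vol (polar (L i)) `^ (p / (n%:R + p)).
Proof.
by rewrite /polar_weight -prodrXl; apply: eq_bigr => i _; exact: weight_rootK.
Qed.

(* The suprema of [G] range over constant families for [alpha = 1] and over all
   families for [alpha = 2]. *)
Definition test_families (alpha : nat) : set ('I_n -> set 'rV[R]_n) :=
  [set L | (forall j, K0 (L j)) /\ (alpha = 1%N -> forall i j, L i = L j)].

Lemma GE alpha K : G alpha p K =
  ereal_sup [set geominimal_value (mixed_Vp p K L) (polar_weight L)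
            | L in test_families alpha].
Proof.
rewrite /G; case: eqP => [->|alpha1].
  congr ereal_sup; apply/seteqP; split=> [_ [M hM <-]|_ [L [hL cL] <-]].
    by exists (fun=> M) => //; rewrite polar_weight_cst.
  have -> : L = fun=> L (Ordinal n_gt0) by apply/funext => j; exact: cL.
  by exists (L (Ordinal n_gt0)) => //; rewrite polar_weight_cst.
by congr ereal_sup; apply/seteqP; split=> [_ [L hL <-]|_ [L [hL _] <-]]; exists L.
Qed.

Lemma test_families_tail alpha m (hmn : (m <= n)%N) L i :
  test_families alpha L -> test_families alpha (tail_family hmn L i).
Proof.
move=> [hL cL]; split=> [j|alpha1 j k]; rewrite /tail_family.
  by case: ifP.
by do 2 case: ifP => _; exact: cL.
Qed.

Variables (alpha : nat) (K : 'I_n -> set 'rV[R]_n).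
Hypothesis hK : forall i, F0 (K i).

Lemma G_expe_le m (z : \bar R) : (0 < m)%N ->
  (forall L, test_families alpha L ->
    geominimal_value (mixed_Vp p K L) (polar_weight L) ^+ m <= z)%E ->
  (G alpha p K ^+ m <= z)%E.
Proof.
move=> m0 Hz; rewrite GE; apply: ereal_sup_expe_le => //.
- have [kK _ _] := hK (Ordinal n_gt0).
  (* The constant family with value K_1 is admissible for either [alpha], so the supremum is over a
     nonempty set. *)
  eexists; exists (fun=> K (Ordinal n_gt0)); last by [].
  by split.
- by move=> _ [L _ <-]; apply: geominimal_value_ge0; exact: polar_weight_ge0.
- by move=> _ [L hL <-]; exact: Hz.
Qed.

(** Replacing the tail of [L] gives an admissible family for the correspondingly replaced bodies, so
    every factor is bounded by its supremum. *)
Lemma G_expe_le_tail m (hmn : (m <= n)%N) : (0 < m)%N ->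
  (G alpha p K ^+ m <= \prod_(i < m) G alpha p (tail_family hmn K i))%E.
Proof.
move=> m0; apply: G_expe_le => // L tL; have [hL _] := tL.
apply: (le_trans (geominimal_value_expe_le (mixed_Vp_ge0 _ _) (polar_weight_ge0 _)
  _ (mixed_Vp_expe_le hmn m0 hK hL) (polar_weight_tail hmn L))).
  by move=> i; exact: mixed_Vp_ge0.
apply: lee_prod => i; first by apply: geominimal_value_ge0; exact: polar_weight_ge0.
rewrite GE; apply: ereal_sup_ubound; exists (tail_family hmn L i) => //.
exact: test_families_tail.
Qed.

Lemma G_expe_le_geominimal :
  (G alpha p K ^+ n <= \prod_(i < n) geominimal p (K i))%E.
Proof.
apply: G_expe_le => // L [hL _].
apply: (le_trans (geominimal_value_expe_le (mixed_Vp_ge0 _ _) (polar_weight_ge0 _)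
  _ (mixed_Vp_expe_le_Vp hK hL) (polar_weight_expn L))).
  by move=> i; exact: Vp_ge0.
apply: lee_prod => i; first by apply: geominimal_value_ge0; exact: powR_ge0.
by apply: ereal_sup_ubound; exists (L i).
Qed.

End mixed_geominimal.

(* The bodies K_1, ..., K_n are K 0, ..., K (n-1), so K_(n-i) is
   K (rev_ord i). *)
Theorem theorem5p1 (R : realType) (n : nat) (p : R) (alpha : nat)
    (K : 'I_n -> set 'rV[R]_n)
    (hK : forall i, F0 (K i)) (hp : - n%:R < p < 0)
    (halpha : alpha = 1%N \/ alpha = 2%N) :
  (forall (m : nat) (hm : (1 <= m)%N) (hmn : (m <= n)%N),
     (G alpha p K ^+ m <=
      \prod_(i < m)
        G alpha p (fun j : 'I_n =>
          if (j < n - m)%N then K j else K (rev_ord (widen_ord hmn i))))%E) /\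
  (G alpha p K ^+ n <= \prod_(i < n) geominimal p (K i))%E.
Proof.
split=> [m hm hmn|]; first exact: G_expe_le_tail.
exact: G_expe_le_geominimal.
Qed.
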